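(* Let $\delta_1,\delta_2,\delta_3$ be distinct, all chosen to be integers or half-integers, with $\delta_1>\max(\delta_2,\delta_3)$. The plane wave reduction (as described in the context) of the linear system $$T_{-1,3}\Psi_{1,2}+T\,\Psi_{2,3}=T_{2,3}\Psi,\qquad T\,\Psi_{-1,2}+T_{-1,3}\Psi_{2,-3}=T_{-1,2}\Psi$$ is $$Y_m\,\phi_{m+\delta_1+\delta_2}+\beta\zeta\,\phi_{m+\delta_2+\delta_3}=\xi\,\phi_m,\qquad \phi_{m+\delta_1-\delta_2}-X_m\,\phi_{m+\delta_1-\delta_3}=\zeta\,\phi_m,\quad ( * )$$ where $$X_m=\frac{\tau_{m+2\delta_1-2\delta_3}\,\tau_{m+\delta_1-\delta_2}}{\tau_{m+2\delta_1-\delta_2-\delta_3}\,\tau_{m+\delta_1-\delta_3}},\qquad Y_m=\frac{\tau_{m+2\delta_1+\delta_2-\delta_3}\,\tau_{m}}{\tau_{m+\delta_1+\delta_2}\,\tau_{m+\delta_1-\delta_3}}.$$ The compatibility condition of $( * )$ is a Somos-$N$ recurrence with a periodic coefficient, given by $$\tau_{m+N}\tau_{m}=\alpha_m\,\tau_{m+\delta_1+\delta_2}\tau_{m+\delta_1-\delta_2}+\beta\,\tau_{m+\delta_1+\delta_3}\tau_{m+\delta_1-\delta_3},\qquad \alpha_{m+\delta_1-\delta_3}=\alpha_m,$$ with $N=2\delta_1$.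
   Context: $T$ (tau function) and $\Psi$ (wave function) are functions of three independent variables $(m_1,m_2,m_3)$. Subscripts on $T$ and $\Psi$ denote unit shifts: $F_{\pm i}$ is $F$ with $m_i$ replaced by $m_i\pm1$, and $F_{\pm i,\pm j}$ is $F$ with both $m_i$ and $m_j$ so shifted, e.g. $T_{-1,3}=T(m_1-1,m_2,m_3+1)$. The linear system for $\Psi$ is the Lax pair of the Hirota–Miwa equation $T_1T_{-1}=T_2T_{-2}+T_3T_{-3}$; its compatibility condition is not exactly that equation but $R_{1,-3}=R$, where $R=(T_1T_{-1}-T_3T_{-3})/(T_2T_{-2})$. Plane wave reduction: one substitutes $$T(m_1,m_2,m_3)=a_1^{m_1^2}a_2^{m_2^2}a_3^{m_3^2}\,\tau_m,\qquad \Psi(m_1,m_2,m_3)=\lambda_1^{m_1}\lambda_2^{m_2}\lambda_3^{m_3}\,T(m_1,m_2,m_3)\,\phi_m,$$ with $m=m_0+\delta_1m_1+\delta_2m_2+\delta_3m_3$ ($m_0$ arbitrary), where $a_1,a_2,a_3$ are arbitrary parameters, $\lambda_1,\lambda_2,\lambda_3$ are spectral parameters, and $$\beta=\frac{a_3^2}{a_1^2},\qquad \zeta=\lambda_2\lambda_1^{-1},\qquad \xi=(a_1^2\lambda_1\lambda_2)^{-1},\qquad \lambda_3=a_3^2\lambda_2 .$$ After the substitution the index $m$ is relabelled: the second equation is shifted by $\delta_1-\delta_2$, and an overall shift $m\to m+\delta_1-\delta_3$ is made in the $\tau$ variables forming the coefficients $X_m,Y_m$. The compatibility condition of the reduced system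 is obtained by substituting the same form of $T$ into $R_{1,-3}=R$. *)

(* Defs.v *)
From mathcomp Require Import all_boot all_order all_algebra.

Set Implicit Arguments.
Unset Strict Implicit.
Unset Printing Implicit Defensive.

Import Order.TTheory GRing.Theory Num.Theory.
Local Open Scope ring_scope.

Definition lax_eq1 (F : fieldType) (T Psi : int -> int -> int -> F)
    (m1 m2 m3 : int) : Prop :=
  T (m1 - 1) m2 (m3 + 1) * Psi (m1 + 1) (m2 + 1) m3
    + T m1 m2 m3 * Psi m1 (m2 + 1) (m3 + 1)
  = T m1 (m2 + 1) (m3 + 1) * Psi m1 m2 m3.

Definition lax_eq2 (F : fieldType) (T Psi : int -> int -> int -> F)
    (m1 m2 m3 : int) : Prop :=
  T m1 m2 m3 * Psi (m1 - 1) (m2 + 1) m3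
    + T (m1 - 1) m2 (m3 + 1) * Psi m1 (m2 + 1) (m3 - 1)
  = T (m1 - 1) (m2 + 1) m3 * Psi m1 m2 m3.

Definition hm_ratio (F : fieldType) (T : int -> int -> int -> F)
    (m1 m2 m3 : int) : F :=
  (T (m1 + 1) m2 m3 * T (m1 - 1) m2 m3 - T m1 m2 (m3 + 1) * T m1 m2 (m3 - 1))
  / (T m1 (m2 + 1) m3 * T m1 (m2 - 1) m3).

(* R_{1,-3} = R, the compatibility condition of lax_eq1, lax_eq2. *)
Definition hm_compatibility (F : fieldType) (T : int -> int -> int -> F) : Prop :=
  forall m1 m2 m3 : int, hm_ratio T (m1 + 1) m2 (m3 - 1) = hm_ratio T m1 m2 m3.

(* "Half-integer" means an element of Z + 1/2. *)
Definition int_or_half_int (K : numFieldType) (x : K) : Prop :=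
  exists k : int, x = k%:~R \/ x = k%:~R + 2^-1.

Definition pw_index (K : numFieldType) (m0 d1 d2 d3 : K) (m1 m2 m3 : int) : K :=
  m0 + d1 * m1%:~R + d2 * m2%:~R + d3 * m3%:~R.

(* tau_m, phi_m, X_m, Y_m, alpha_m are only meaningful for m in this set, which
   is stable under translation by each of +-d1, +-d2, +-d3. *)
Definition on_lattice (K : numFieldType) (m0 d1 d2 d3 m : K) : Prop :=
  exists m1 m2 m3 : int, m = pw_index m0 d1 d2 d3 m1 m2 m3.

Definition pw_T (K : numFieldType) (F : fieldType) (m0 d1 d2 d3 : K)
    (a1 a2 a3 : F) (tau : K -> F) (m1 m2 m3 : int) : F :=
  a1 ^ (m1 ^+ 2) * a2 ^ (m2 ^+ 2) * a3 ^ (m3 ^+ 2)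
  * tau (pw_index m0 d1 d2 d3 m1 m2 m3).

Definition pw_Psi (K : numFieldType) (F : fieldType) (m0 d1 d2 d3 : K)
    (a1 a2 a3 l1 l2 l3 : F) (tau phi : K -> F) (m1 m2 m3 : int) : F :=
  l1 ^ m1 * l2 ^ m2 * l3 ^ m3 * pw_T m0 d1 d2 d3 a1 a2 a3 tau m1 m2 m3
  * phi (pw_index m0 d1 d2 d3 m1 m2 m3).

Definition redX (K : numFieldType) (F : fieldType) (d1 d2 d3 : K)
    (tau : K -> F) (m : K) : F :=
  (tau (m + 2 * d1 - 2 * d3) * tau (m + d1 - d2))
  / (tau (m + 2 * d1 - d2 - d3) * tau (m + d1 - d3)).

Definition redY (K : numFieldType) (F : fieldType) (d1 d2 d3 : K)
    (tau : K -> F) (m : K) : F :=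
  (tau (m + 2 * d1 + d2 - d3) * tau m)
  / (tau (m + d1 + d2) * tau (m + d1 - d3)).

(* The reduced linear system is  op1 phi = xi phi,  op2 phi = zeta phi. *)
Definition op1 (K : numFieldType) (F : fieldType) (d1 d2 d3 : K)
    (beta zeta : F) (tau phi : K -> F) (m : K) : F :=
  redY d1 d2 d3 tau m * phi (m + d1 + d2) + beta * zeta * phi (m + d2 + d3).

Definition op2 (K : numFieldType) (F : fieldType) (d1 d2 d3 : K)
    (tau phi : K -> F) (m : K) : F :=
  phi (m + d1 - d2) - redX d1 d2 d3 tau m * phi (m + d1 - d3).

(* Because zeta also occurs in op1, the operators are required to commute not on
   all functions but on the solutions of op2 phi = zeta phi: equivalently, op1
   (whose eigenvalue is xi) maps that solution space to itself. Imposing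
   op1 phi = xi phi as well would make the condition vacuous. *)
Definition reduced_compatible (K : numFieldType) (F : fieldType)
    (m0 d1 d2 d3 : K) (beta zeta : F) (tau : K -> F) : Prop :=
  forall phi : K -> F,
    (forall m, on_lattice m0 d1 d2 d3 m ->
       op2 d1 d2 d3 tau phi m = zeta * phi m) ->
    forall m, on_lattice m0 d1 d2 d3 m ->
      op1 d1 d2 d3 beta zeta tau (op2 d1 d2 d3 tau phi) m
      = op2 d1 d2 d3 tau (op1 d1 d2 d3 beta zeta tau phi) m.

Definition somos_periodic (K : numFieldType) (F : fieldType)
    (m0 d1 d2 d3 N : K) (beta : F) (tau : K -> F) : Prop :=
  exists alpha : K -> F, forall m, on_lattice m0 d1 d2 d3 m ->
    tau (m + N) * tau m
      = alpha m * tau (m + d1 + d2) * tau (m + d1 - d2)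
        + beta * tau (m + d1 + d3) * tau (m + d1 - d3)
    /\ alpha (m + d1 - d3) = alpha m.

(* Main.v *)
(* On the solutions of [op2 phi = zeta phi] the terms of the commutator of op1
   and op2 at [phi (m + 2 d1 + d2 - d3)] cancel identically, and what remains is
   a nonzero multiple of [(alpha_{m+d1-d3} - alpha_m) phi (m + d1 + d2)], where
   alpha is the coefficient solved for in the Somos relation. Conversely,
   the d_i are half-integers, so the lattice embeds in a coset of Z/2, on which
   [op2 phi = zeta phi] is a three-term recurrence with nonzero coefficients;
   it has a solution taking the value 1 at any prescribed point, which forces
   alpha to be periodic. The ratio R is alpha up to a constant and a shift. *)

Require Import Defs.
From mathcomp Require Import all_boot all_order all_algebra.
From mathcomp Require Import zify ring.
From Stdlib Require Import ClassicalEpsilon.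

Set Implicit Arguments.
Unset Strict Implicit.
Unset Printing Implicit Defensive.

Import Order.TTheory GRing.Theory Num.Theory.
Local Open Scope ring_scope.

(** * Three-term recurrences on the integers *)

Section ThreeTermRecurrence.

Variables (F : fieldType) (p q : int) (A B C : int -> F).
Hypotheses (q_gt0 : 0 < q) (lt_qp : q < p).
Hypotheses (A0 : forall n, A n != 0) (C0 : forall n, C n != 0).

(* The recurrence is run forwards on [p <= n] and backwards on [n < 0], with
   initial values 1 on the window [0 <= n < p]; [k] is fuel. *)
Fixpoint three_term_iter (k : nat) (n : int) : F :=
  if k is k'.+1 then
    if p <= n then
      - (B (n - p) * three_term_iter k' (n - p + q)
         + C (n - p) * three_term_iter k' (n - p)) / A (n - p)
    else if n < 0 then
      - (A n * three_term_iter k' (n + p) + B n * three_term_iter k' (n + q))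
      / C n
    else 1
  else 1.

Definition three_term (n : int) : F := three_term_iter `|n|%N n.

Lemma three_term_window k n : 0 <= n -> n < p -> three_term_iter k n = 1.
Proof.
by case: k => //= k n0 np; rewrite [p <= n]leNgt np /= ltNge n0.
Qed.

(** Each recursive call either lands in the window or strictly decreases [|n|], thanks to
    [0 < q < p]. Hence [|n|] units of fuel suffice and any surplus is harmless. *)
Lemma three_term_stable k n :
  (0 <= n < p) || (`|n| <= k)%N -> three_term_iter k n = three_term n.
Proof.
rewrite /three_term => /orP[/andP[n0 np]|]; first by rewrite !three_term_window.
have step : forall k n, (`|n| <= k)%N ->
    three_term_iter k.+1 n = three_term_iter k n.
  elim=> [|{}k IHk] {}n nk; first by rewrite three_term_window //; lia.
  have dep d : 0 <= d < p \/ (`|d| <= k)%N ->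
      three_term_iter k.+1 d = three_term_iter k d.
    by case=> [/andP[d0 dp]|/IHk//]; rewrite !three_term_window.
  rewrite [LHS]/= [RHS]/=; case: ifP => [pn|np].
    by rewrite -!/(three_term_iter k.+1 _) !dep //; right; lia.
  case: ifP => // n0; rewrite -!/(three_term_iter k.+1 _) !dep //; lia.
move=> /subnK <-; elim: (k - _)%N => // j IHj.
by rewrite addSn step ?IHj // leq_addl.
Qed.

Lemma three_termP n :
  A n * three_term (n + p) + B n * three_term (n + q) + C n * three_term n = 0.
Proof.
have An := A0 n; have Cn := C0 n.
have [n0|n0] := leP 0 n.
  (* A surplus unit of fuel lets one unfolding expose the forward clause at [n + p], which is the
     recurrence at [n] solved for its leading term. For negative [n] the backward clause at [n]
     plays this part. *)
  rewrite -(@three_term_stable `|n + p|.+1 (n + p)) /=; last by rewrite leqnSn orbT.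
  rewrite lerDr n0 !addrK !three_term_stable; try lia.
  by field.
rewrite -(@three_term_stable `|n| n) ?leqnn ?orbT //.
have -> : `|n|%N = `|n|.-1.+1 by lia.
rewrite [three_term_iter _.+1 n]/=.
have -> : p <= n = false by lia.
rewrite n0 !three_term_stable; try lia.
by field.
Qed.

Lemma three_term0 : three_term 0 = 1.
Proof. by rewrite /three_term three_term_window //; lia. Qed.

End ThreeTermRecurrence.

(** When [p < q] the roles of [A] and [B] are exchanged, so that the coefficient of the farthest
    term is again invertible. *)
Lemma three_term_solution (F : fieldType) (p q : int) (A B C : int -> F) :
    0 < p -> 0 < q -> p != q ->
    (forall n, A n != 0) -> (forall n, B n != 0) -> (forall n, C n != 0) ->
  exists2 f : int -> F, f 0 = 1 &
    forall n, A n * f (n + p) + B n * f (n + q) + C n * f n = 0.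
Proof.
move=> p0 q0 pq A0 B0 C0; case: (ltgtP p q) pq => // lt_pq _.
  exists (three_term q p B A C); first exact: three_term0.
  by move=> n; rewrite [X in X + _]addrC; apply: three_termP.
exists (three_term p q A B C); first exact: three_term0.
by move=> n; apply: three_termP.
Qed.

(** * Half-integers, quadratic exponents and proportional equations *)

Lemma int_or_half_intE (K : numFieldType) (x : K) :
  int_or_half_int x -> exists k : int, x = k%:~R / 2.
Proof.
case=> k [->|->]; [exists (k * 2)|exists (k * 2 + 1)];
  by rewrite !(rmorphD, rmorphM) /=; field.
Qed.

(** Expresses a shifted quadratic exponent through [a ^ (n ^+ 2)], [a ^ n] and [a], which can then
    serve as atoms for [field]. *)
Lemma exp_sqrD1 (F : fieldType) (a : F) (n : int) :
  a != 0 -> a ^ ((n + 1) ^+ 2) = a ^ (n ^+ 2) * (a ^ n) ^+ 2 * a.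
Proof.
move=> a0; rewrite -[X in _ * X]expr1z [(a ^ n) ^+ 2]expr2 -!expfzDr //.
by congr (a ^ _); ring.
Qed.

Lemma exp_sqrB1 (F : fieldType) (a : F) (n : int) :
  a != 0 -> a ^ ((n - 1) ^+ 2) = a ^ (n ^+ 2) / (a ^ n) ^+ 2 * a.
Proof.
move=> a0; rewrite -[X in _ * X]expr1z [(a ^ n) ^+ 2]expr2 -!expfzDr //.
rewrite invr_expz -!expfzDr //.
by congr (a ^ _); ring.
Qed.

(** Reduces the equivalence of two equations to one rational identity, within reach of [field]. *)
Lemma eq_scaled (F : fieldType) (c x y x' y' : F) :
  c != 0 -> x - y = c * (x' - y') -> (x = y <-> x' = y').
Proof.
move=> c0 xy; split=> e; apply/eqP; rewrite -subr_eq0.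
  by move/eqP: xy; rewrite e subrr eq_sym mulf_eq0 (negPf c0).
by rewrite xy e subrr mulr0.
Qed.

Ltac index_ring := rewrite /pw_index !(rmorphD, rmorphN) /=; ring.

(** * The index lattice and nonvanishing of tau on it *)

Section Lattice.

Context (K : numFieldType) (F : fieldType).
Variables (m0 d1 d2 d3 : K) (tau : K -> F).

Local Notation lattice := (on_lattice m0 d1 d2 d3).
Local Notation index := (pw_index m0 d1 d2 d3).

Lemma pw_indexD m1 m2 m3 (i j k : int) :
  index (m1 + i) (m2 + j) (m3 + k)
  = index m1 m2 m3 + (d1 * i%:~R + d2 * j%:~R + d3 * k%:~R).
Proof. by rewrite /pw_index !rmorphD /=; ring. Qed.

Lemma on_latticeD (i j k : int) {m : K} :
  lattice m -> lattice (m + (d1 * i%:~R + d2 * j%:~R + d3 * k%:~R)).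
Proof.
move=> [m1 [m2 [m3 ->]]]; exists (m1 + i), (m2 + j), (m3 + k).
by rewrite pw_indexD.
Qed.

Lemma on_lattice_index m1 m2 m3 : lattice (index m1 m2 m3).
Proof. by exists m1, m2, m3. Qed.

Hypothesis tau_neq0 : forall m, lattice m -> tau m != 0.

Lemma tau_shift_neq0 (i j k : int) {m m' : K} :
  lattice m -> m' = m + (d1 * i%:~R + d2 * j%:~R + d3 * k%:~R) -> tau m' != 0.
Proof. by move=> /(on_latticeD i j k) /tau_neq0 ? ->. Qed.

Arguments tau_shift_neq0 i j k {m m'} _ _.

Lemma redX_neq0 m : lattice m -> redX d1 d2 d3 tau m != 0.
Proof.
move=> mL; rewrite /redX mulf_eq0 invr_eq0 !mulf_eq0 !negb_or -!andbA; apply/and4P; split.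
- by apply: (tau_shift_neq0 2 0 (- 2) mL); ring.
- by apply: (tau_shift_neq0 1 (- 1) 0 mL); ring.
- by apply: (tau_shift_neq0 2 (- 1) (- 1) mL); ring.
- by apply: (tau_shift_neq0 1 0 (- 1) mL); ring.
Qed.

(** * The Somos coefficient and identities between X and Y *)

Definition somos_coef (beta : F) (m : K) : F :=
  (tau (m + 2 * d1) * tau m - beta * tau (m + d1 + d3) * tau (m + d1 - d3))
  / (tau (m + d1 + d2) * tau (m + d1 - d2)).

(** The tau values multiplying [alpha m] are nonzero on the lattice, so the Somos relation
    determines [alpha] there and only its periodicity remains to be imposed. *)
Lemma somos_periodicE (beta : F) :
  somos_periodic m0 d1 d2 d3 (2 * d1) beta tau <->
  forall m, lattice m -> somos_coef beta (m + d1 - d3) = somos_coef beta m.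
Proof.
have nz m : lattice m -> tau (m + d1 + d2) != 0 /\ tau (m + d1 - d2) != 0.
  by move=> mL; split; [apply: (tau_shift_neq0 1 1 0 mL)
                       |apply: (tau_shift_neq0 1 (- 1) 0 mL)]; ring.
split=> [[alpha alphaP] m mL|per].
  have alphaE n : lattice n -> somos_coef beta n = alpha n.
    move=> nL; have [n1 n2] := nz n nL; have [e _] := alphaP n nL.
    by rewrite /somos_coef e; field; rewrite n1 n2.
  have mL' : lattice (m + d1 - d3).
    by move: (on_latticeD 1 0 (- 1) mL); congr on_lattice; ring.
  by rewrite !alphaE //; have [] := alphaP m mL.
exists (somos_coef beta) => m mL; split; last exact: per.
by have [n1 n2] := nz m mL; rewrite /somos_coef; field; rewrite n1 n2.
Qed.

(* Both [Y_{m+d1-d2} - beta X_m] and [Y_m - beta X_{m+d2+d3}] are multiples of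
   a Somos coefficient, at [m + d1 - d3] and at [m], with the same factor. *)
Lemma redY_redX_somos (beta : F) m : lattice m ->
  (redY d1 d2 d3 tau (m + d1 - d2) - redY d1 d2 d3 tau m
     + beta * (redX d1 d2 d3 tau (m + d2 + d3) - redX d1 d2 d3 tau m))
  = tau (m + d1 - d2) * tau (m + 2 * d1 + d2 - d3)
    / (tau (m + 2 * d1) * tau (m + d1 - d3))
    * (somos_coef beta (m + d1 - d3) - somos_coef beta m).
Proof.
move=> mL.
(* [field] treats [tau x] as an atom, so arguments equal up to [ring] are first brought to one
   common form. *)
have tauE x y : x = y -> tau x = tau y by move->.
rewrite /redX /redY /somos_coef.
rewrite (tauE (m + d1 - d2 + 2 * d1 + d2 - d3) (m + 3 * d1 - d3)); last by ring.
rewrite (tauE (m + d1 - d2 + d1 + d2) (m + 2 * d1)); last by ring.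
rewrite (tauE (m + d1 - d2 + d1 - d3) (m + 2 * d1 - d2 - d3)); last by ring.
rewrite (tauE (m + d2 + d3 + 2 * d1 - 2 * d3) (m + 2 * d1 + d2 - d3)); last by ring.
rewrite (tauE (m + d2 + d3 + d1 - d2) (m + d1 + d3)); last by ring.
rewrite (tauE (m + d2 + d3 + 2 * d1 - d2 - d3) (m + 2 * d1)); last by ring.
rewrite (tauE (m + d2 + d3 + d1 - d3) (m + d1 + d2)); last by ring.
rewrite (tauE (m + d1 - d3 + 2 * d1) (m + 3 * d1 - d3)); last by ring.
rewrite (tauE (m + d1 - d3 + d1 + d3) (m + 2 * d1)); last by ring.
rewrite (tauE (m + d1 - d3 + d1 - d3) (m + 2 * d1 - 2 * d3)); last by ring.
rewrite (tauE (m + d1 - d3 + d1 + d2) (m + 2 * d1 + d2 - d3)); last by ring.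
rewrite (tauE (m + d1 - d3 + d1 - d2) (m + 2 * d1 - d2 - d3)); last by ring.
have n1 : tau (m + 2 * d1) != 0 by apply: (tau_shift_neq0 2 0 0 mL); ring.
have n2 : tau (m + 2 * d1 - d2 - d3) != 0
  by apply: (tau_shift_neq0 2 (- 1) (- 1) mL); ring.
have n3 : tau (m + d1 + d2) != 0 by apply: (tau_shift_neq0 1 1 0 mL); ring.
have n4 : tau (m + d1 - d3) != 0 by apply: (tau_shift_neq0 1 0 (- 1) mL); ring.
have n5 : tau (m + d1 - d2) != 0 by apply: (tau_shift_neq0 1 (- 1) 0 mL); ring.
have n6 : tau (m + 2 * d1 + d2 - d3) != 0
  by apply: (tau_shift_neq0 2 1 (- 1) mL); ring.
by field; rewrite n1 n2 n3 n4 n5 n6.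
Qed.

(** Both products telescope to the same quotient of four tau values. This is the vanishing of the
    coefficient of [phi (m + 2 * d1 + d2 - d3)] in the commutator. *)
Lemma redY_redX_comm m : lattice m ->
  redY d1 d2 d3 tau (m + d1 - d2) * redX d1 d2 d3 tau (m + d1 + d2)
  = redX d1 d2 d3 tau m * redY d1 d2 d3 tau (m + d1 - d3).
Proof.
move=> mL.
have tauE x y : x = y -> tau x = tau y by move->.
rewrite /redX /redY.
rewrite (tauE (m + d1 - d2 + 2 * d1 + d2 - d3) (m + 3 * d1 - d3)); last by ring.
rewrite (tauE (m + d1 - d2 + d1 + d2) (m + 2 * d1)); last by ring.
rewrite (tauE (m + d1 - d2 + d1 - d3) (m + 2 * d1 - d2 - d3)); last by ring.
rewrite (tauE (m + d1 + d2 + 2 * d1 - 2 * d3) (m + 3 * d1 + d2 - 2 * d3));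
  last by ring.
rewrite (tauE (m + d1 + d2 + d1 - d2) (m + 2 * d1)); last by ring.
rewrite (tauE (m + d1 + d2 + 2 * d1 - d2 - d3) (m + 3 * d1 - d3)); last by ring.
rewrite (tauE (m + d1 + d2 + d1 - d3) (m + 2 * d1 + d2 - d3)); last by ring.
rewrite (tauE (m + d1 - d3 + 2 * d1 + d2 - d3) (m + 3 * d1 + d2 - 2 * d3));
  last by ring.
rewrite (tauE (m + d1 - d3 + d1 + d2) (m + 2 * d1 + d2 - d3)); last by ring.
rewrite (tauE (m + d1 - d3 + d1 - d3) (m + 2 * d1 - 2 * d3)); last by ring.
have n1 : tau (m + 2 * d1) != 0 by apply: (tau_shift_neq0 2 0 0 mL); ring.
have n2 : tau (m + 2 * d1 - d2 - d3) != 0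
  by apply: (tau_shift_neq0 2 (- 1) (- 1) mL); ring.
have n3 : tau (m + 3 * d1 - d3) != 0 by apply: (tau_shift_neq0 3 0 (- 1) mL); ring.
have n4 : tau (m + d1 - d3) != 0 by apply: (tau_shift_neq0 1 0 (- 1) mL); ring.
have n5 : tau (m + 2 * d1 - 2 * d3) != 0
  by apply: (tau_shift_neq0 2 0 (- 2) mL); ring.
have n6 : tau (m + 2 * d1 + d2 - d3) != 0
  by apply: (tau_shift_neq0 2 1 (- 1) mL); ring.
by field; rewrite n1 n2 n3 n4 n5 n6.
Qed.

(** * Compatibility of the reduced system *)

(** Writing [d_i = e_i / 2] and [m = c + k / 2] turns the equation into a recurrence in [k] with
    steps [e1 - e2] and [e1 - e3], positive and distinct by the hypotheses on the shifts. The
    prescribed point [c] becomes [k = 0]. *)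
Lemma op2_solution (zeta : F) (c : K) :
    int_or_half_int d1 -> int_or_half_int d2 -> int_or_half_int d3 ->
    d2 < d1 -> d3 < d1 -> d2 != d3 -> zeta != 0 -> lattice c ->
  exists2 phi : K -> F, phi c = 1 &
    forall m, lattice m -> op2 d1 d2 d3 tau phi m = zeta * phi m.
Proof.
move=> /int_or_half_intE[e1 d1E] /int_or_half_intE[e2 d2E].
move=> /int_or_half_intE[e3 d3E] lt21 lt31 neq23 zeta0 cL.
have half_lt (x y : int) : (x%:~R / 2 < y%:~R / 2 :> K) = (x < y).
  by rewrite ltr_pM2r ?invr_gt0 ?ltr0n // ltr_int.
have pt_inj : injective (fun k : int => c + k%:~R / 2).
  move=> k l /addrI /(mulIf _) kl; apply: (@intr_inj K); apply: kl.
  by rewrite invr_eq0 pnatr_eq0.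
(* [redX] may vanish off the lattice, since division by zero gives zero. *)
pose X k : F := let x := redX d1 d2 d3 tau (c + k%:~R / 2) in
  if x == 0 then 1 else x.
have X0 k : - X k != 0 by rewrite oppr_eq0 /X; case: ifPn => // _; apply: oner_neq0.
have p0 : 0 < e1 - e2 by rewrite subr_gt0 -half_lt -d1E -d2E.
have q0 : 0 < e1 - e3 by rewrite subr_gt0 -half_lt -d1E -d3E.
have pq : e1 - e2 != e1 - e3.
  by apply: contraNneq neq23 => /addrI/oppr_inj e; rewrite d2E d3E e.
have [f f0 fP] := @three_term_solution F _ _ (fun=> 1) (fun k => - X k)
  (fun=> - zeta) p0 q0 pq (fun=> oner_neq0 F) X0
  (fun=> etrans (congr1 negb (oppr_eq0 zeta)) zeta0).
(* Decodes a point of the coset into its integer coordinate, unique by [pt_inj]; off the coset the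
   value is arbitrary. *)
pose phi x := f (epsilon (inhabits 0) (fun k : int => x = c + k%:~R / 2)).
have phiE k : phi (c + k%:~R / 2) = f k.
  rewrite /phi; congr f; apply: pt_inj; symmetry.
  by apply: (epsilon_spec (inhabits 0)
    (fun l : int => c + k%:~R / 2 = c + l%:~R / 2)); exists k.
exists phi.
  by rewrite -[c in phi c]addr0 -[0](mul0r 2^-1) -[X in X / 2]/(0%:~R) phiE.
move=> m mL; have [k mE] : exists k : int, m = c + k%:~R / 2.
  move: cL mL => [i1 [i2 [i3 ->]]] [j1 [j2 [j3 ->]]].
  exists (e1 * (j1 - i1) + e2 * (j2 - i2) + e3 * (j3 - i3)).
  by rewrite /pw_index d1E d2E d3E !(rmorphD, rmorphM, rmorphN) /=; field.
have XE : X k = redX d1 d2 d3 tau m.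
  by rewrite /X -mE; have /negPf -> := redX_neq0 mL.
rewrite /op2 -XE.
have -> : m + d1 - d2 = c + (k + (e1 - e2))%:~R / 2.
  by rewrite mE d1E d2E !(rmorphD, rmorphN) /=; field.
have -> : m + d1 - d3 = c + (k + (e1 - e3))%:~R / 2.
  by rewrite mE d1E d3E !(rmorphD, rmorphN) /=; field.
rewrite mE !phiE; apply/eqP; rewrite -subr_eq0 -(fP k); apply/eqP; ring.
Qed.

(** The equation at [m + d1 + d2] and [m + d2 + d3] serves twice: to replace [op2 phi] by
    [zeta * phi] inside [op1], and to eliminate [phi (m + 2 * d1)] and [phi (m + d1 + d3)]. *)
Lemma op1_op2_comm (beta zeta : F) (phi : K -> F) m :
    (forall m, lattice m -> op2 d1 d2 d3 tau phi m = zeta * phi m) ->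
    lattice m ->
  op2 d1 d2 d3 tau (op1 d1 d2 d3 beta zeta tau phi) m
    - op1 d1 d2 d3 beta zeta tau (op2 d1 d2 d3 tau phi) m
  = zeta * (redY d1 d2 d3 tau (m + d1 - d2) - redY d1 d2 d3 tau m
     + beta * (redX d1 d2 d3 tau (m + d2 + d3) - redX d1 d2 d3 tau m))
    * phi (m + d1 + d2).
Proof.
move=> phiP mL.
have mL12 : lattice (m + d1 + d2).
  by move: (on_latticeD 1 1 0 mL); congr on_lattice; ring.
have mL23 : lattice (m + d2 + d3).
  by move: (on_latticeD 0 1 1 mL); congr on_lattice; ring.
rewrite {2}/op1 !phiP //.
have := phiP _ mL12; have := phiP _ mL23; rewrite /op2 /op1.
have phiE x y : x = y -> phi x = phi y by move->.
rewrite (phiE (m + d2 + d3 + d1 - d2) (m + d1 + d3)); last by ring.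
rewrite (phiE (m + d2 + d3 + d1 - d3) (m + d1 + d2)); last by ring.
rewrite (phiE (m + d1 + d2 + d1 - d2) (m + 2 * d1)); last by ring.
rewrite (phiE (m + d1 + d2 + d1 - d3) (m + 2 * d1 + d2 - d3)); last by ring.
rewrite (phiE (m + d1 - d2 + d1 + d2) (m + 2 * d1)); last by ring.
rewrite (phiE (m + d1 - d2 + d2 + d3) (m + d1 + d3)); last by ring.
rewrite (phiE (m + d1 - d3 + d1 + d2) (m + 2 * d1 + d2 - d3)); last by ring.
rewrite (phiE (m + d1 - d3 + d2 + d3) (m + d1 + d2)); last by ring.
move=> /(canRL (subrK _)) -> /(canRL (subrK _)) ->.
(* The terms in [phi (m + d2 + d3)] cancel by themselves; [XYE] removes those in
   [phi (m + 2 * d1 + d2 - d3)]. *)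
have XYE := redY_redX_comm mL.
ring: XYE.
Qed.

Lemma reduced_compatibleE (beta zeta : F) :
    int_or_half_int d1 -> int_or_half_int d2 -> int_or_half_int d3 ->
    d2 < d1 -> d3 < d1 -> d2 != d3 -> zeta != 0 ->
  reduced_compatible m0 d1 d2 d3 beta zeta tau <->
  somos_periodic m0 d1 d2 d3 (2 * d1) beta tau.
Proof.
move=> hd1 hd2 hd3 lt21 lt31 neq23 zeta0; rewrite somos_periodicE.
split=> [compat m mL|per phi phiP m mL]; last first.
  apply/esym/eqP; rewrite -subr_eq0 op1_op2_comm // redY_redX_somos //.
  by rewrite per // subrr !(mulr0, mul0r).
have mL12 : lattice (m + d1 + d2).
  by move: (on_latticeD 1 1 0 mL); congr on_lattice; ring.
(* The solution is normalised at [m + d1 + d2], the only point whose value enters the commutator. *)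
have [phi phi1 phiP] :=
  op2_solution hd1 hd2 hd3 lt21 lt31 neq23 zeta0 mL12.
have := op1_op2_comm beta phiP mL.
rewrite compat // subrr redY_redX_somos // phi1 mulr1 => /esym/eqP.
have n1 : tau (m + 2 * d1) != 0 by apply: (tau_shift_neq0 2 0 0 mL); ring.
have n4 : tau (m + d1 - d3) != 0 by apply: (tau_shift_neq0 1 0 (- 1) mL); ring.
have n5 : tau (m + d1 - d2) != 0 by apply: (tau_shift_neq0 1 (- 1) 0 mL); ring.
have n6 : tau (m + 2 * d1 + d2 - d3) != 0
  by apply: (tau_shift_neq0 2 1 (- 1) mL); ring.
rewrite !(mulf_eq0, invr_eq0) (negPf zeta0) (negPf n1) (negPf n4) (negPf n5).
by rewrite (negPf n6) /= subr_eq0 => /eqP.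
Qed.

(** * Plane wave substitution in the Hirota-Miwa condition *)

Variables (a1 a2 a3 : F).
Hypotheses (a1_neq0 : a1 != 0) (a2_neq0 : a2 != 0) (a3_neq0 : a3 != 0).

Let T := pw_T m0 d1 d2 d3 a1 a2 a3 (fun m => tau (m + d1 - d3)).

(** In a product of opposite shifts the linear exponents cancel: the product along direction [i]
    keeps a factor [a_i ^+ 2] beside a common one. With tau shifted by [d1 - d3], the factor of
    index [m1 - 1] carries tau at the index lowered by [d3], whence [m3 - 1]. *)
Lemma hm_ratioE (m1 m2 m3 : int) :
  hm_ratio T m1 m2 m3
  = a1 ^+ 2 / a2 ^+ 2
    * somos_coef (a3 ^+ 2 / a1 ^+ 2) (index m1 m2 (m3 - 1)).
Proof.
set m := index m1 m2 (m3 - 1).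
have mL : lattice m by apply: on_lattice_index.
have tauE i j k (y : K) :
    index i j k + d1 - d3 = y -> tau (index i j k + d1 - d3) = tau y by move->.
rewrite /hm_ratio /T /pw_T /somos_coef !exp_sqrD1 // !exp_sqrB1 //.
rewrite (tauE _ _ _ (m + 2 * d1)); last by rewrite /m; index_ring.
rewrite (tauE _ _ _ m); last by rewrite /m; index_ring.
rewrite (tauE _ _ _ (m + d1 + d3)); last by rewrite /m; index_ring.
rewrite (tauE _ _ _ (m + d1 - d3)); last by rewrite /m; index_ring.
rewrite (tauE _ _ _ (m + d1 + d2)); last by rewrite /m; index_ring.
rewrite (tauE _ _ _ (m + d1 - d2)); last by rewrite /m; index_ring.
have n3 : tau (m + d1 + d2) != 0 by apply: (tau_shift_neq0 1 1 0 mL); ring.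
have n5 : tau (m + d1 - d2) != 0 by apply: (tau_shift_neq0 1 (- 1) 0 mL); ring.
have := expfz_neq0 m1 a1_neq0; have := expfz_neq0 m2 a2_neq0.
have := expfz_neq0 m3 a3_neq0; have := expfz_neq0 (m1 ^+ 2) a1_neq0.
have := expfz_neq0 (m2 ^+ 2) a2_neq0; have := expfz_neq0 (m3 ^+ 2) a3_neq0.
(* Integer powers are generalised to independent nonzero variables. *)
move: (a1 ^ _) (a2 ^ _) (a3 ^ _) (a1 ^ _) (a2 ^ _) (a3 ^ _).
move=> A1 A2 A3 B1 B2 B3 h1 h2 h3 h4 h5 h6.
by field; rewrite ?(h1, h2, h3, h4, h5, h6, n3, n5, a1_neq0, a2_neq0).
Qed.

(** The shift by [(1, 0, -1)] moves the index by [d1 - d3], the period of [alpha], and the constant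
    in front of the coefficient cancels. *)
Lemma hm_compatibilityE :
  hm_compatibility T <->
  somos_periodic m0 d1 d2 d3 (2 * d1) (a3 ^+ 2 / a1 ^+ 2) tau.
Proof.
have a12 : a1 ^+ 2 / a2 ^+ 2 != 0 by rewrite mulf_neq0 ?invr_neq0 ?expf_neq0.
have shift (m1 m2 m3 : int) :
    index (m1 + 1) m2 (m3 - 1) = index m1 m2 m3 + d1 - d3.
  by index_ring.
rewrite somos_periodicE; split=> [compat m [m1 [m2 [m3 ->]]]|per m1 m2 m3].
  move: (compat m1 m2 (m3 + 1)); rewrite !hm_ratioE => /(mulfI a12).
  by rewrite shift addrK.
by rewrite !hm_ratioE shift per //; apply: on_lattice_index.
Qed.

(** * Plane wave substitution in the Lax pair *)

Variables (l1 l2 : F).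
Hypotheses (l1_neq0 : l1 != 0) (l2_neq0 : l2 != 0).

Let Psi phi :=
  pw_Psi m0 d1 d2 d3 a1 a2 a3 l1 l2 (a3 ^+ 2 * l2)
    (fun m => tau (m + d1 - d3)) phi.

Lemma lax_eq1_reduction (phi : K -> F) m1 m2 m3 :
  lax_eq1 T (Psi phi) m1 m2 m3 <->
  op1 d1 d2 d3 (a3 ^+ 2 / a1 ^+ 2) (l2 * l1^-1) tau phi (index m1 m2 m3)
  = (a1 ^+ 2 * l1 * l2)^-1 * phi (index m1 m2 m3).
Proof.
set m := index m1 m2 m3.
have mL : lattice m by apply: on_lattice_index.
have tauE i j k (y : K) :
    index i j k + d1 - d3 = y -> tau (index i j k + d1 - d3) = tau y by move->.
have phiE i j k (y : K) :
    index i j k = y -> phi (index i j k) = phi y by move->.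
rewrite /lax_eq1 /op1 /redY /Psi /pw_Psi /T /pw_T.
rewrite !exp_sqrD1 // !exp_sqrB1 // !expfzDr ?mulf_neq0 ?expf_neq0 // !expr1z.
rewrite (tauE (m1 - 1) _ _ m); last by rewrite /m; index_ring.
rewrite (tauE (m1 + 1) _ _ (m + 2 * d1 + d2 - d3)); last by rewrite /m; index_ring.
rewrite (tauE m1 (m2 + 1) _ (m + d1 + d2)); last by rewrite /m; index_ring.
rewrite (phiE (m1 + 1) _ _ (m + d1 + d2)); last by rewrite /m; index_ring.
rewrite (phiE _ (m2 + 1) (m3 + 1) (m + d2 + d3)); last by rewrite /m; index_ring.
rewrite -/m.
have n3 : tau (m + d1 + d2) != 0 by apply: (tau_shift_neq0 1 1 0 mL); ring.
have n4 : tau (m + d1 - d3) != 0 by apply: (tau_shift_neq0 1 0 (- 1) mL); ring.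
have := expfz_neq0 m1 a1_neq0; have := expfz_neq0 m2 a2_neq0.
have := expfz_neq0 m3 a3_neq0; have := expfz_neq0 (m1 ^+ 2) a1_neq0.
have := expfz_neq0 (m2 ^+ 2) a2_neq0; have := expfz_neq0 (m3 ^+ 2) a3_neq0.
have := expfz_neq0 m1 l1_neq0; have := expfz_neq0 m2 l2_neq0.
have l3_neq0 : a3 ^+ 2 * l2 != 0 by rewrite mulf_neq0 ?expf_neq0.
have := expfz_neq0 m3 l3_neq0.
move: (l1 ^ m1) (l2 ^ m2) ((a3 ^+ 2 * l2) ^ m3).
move: (a1 ^ (m1 ^+ 2)) (a2 ^ (m2 ^+ 2)) (a3 ^ (m3 ^+ 2)).
move: (a1 ^ m1) (a2 ^ m2) (a3 ^ m3).
move=> B1 B2 B3 A1 A2 A3 L1 L2 L3 h1 h2 h3 h4 h5 h6 h7 h8 h9.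
(* The factor is the coefficient of [phi m] on the right of the Lax equation, divided by [xi]. *)
apply: (@eq_scaled _ (a1 ^+ 2 * l1 * l2 * L1 * L2 * L3 * A1 ^+ 2 * A2 ^+ 2
  * A3 ^+ 2 * B2 ^+ 2 * B3 ^+ 2 * a2 * a3
  * tau (m + d1 - d3) * tau (m + d1 + d2))).
  by rewrite !mulf_neq0 ?expf_neq0.
by field; rewrite ?(h1, h2, h3, h4, h5, h6, h7, h8, h9, n3, n4, a1_neq0,
  a2_neq0, a3_neq0, l1_neq0, l2_neq0).
Qed.

(** Evaluating at [(m1 + 1, m2 - 1, m3)] is the relabelling by [d1 - d2]. The choice
    [l3 = a3 ^+ 2 * l2] normalises the coefficient of [redX] to 1 in absolute terms and, in the
    first equation, yields [beta * zeta]. *)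
Lemma lax_eq2_reduction (phi : K -> F) m1 m2 m3 :
  lax_eq2 T (Psi phi) (m1 + 1) (m2 - 1) m3 <->
  op2 d1 d2 d3 tau phi (index m1 m2 m3)
  = l2 * l1^-1 * phi (index m1 m2 m3).
Proof.
set m := index m1 m2 m3.
have mL : lattice m by apply: on_lattice_index.
have tauE i j k (y : K) :
    index i j k + d1 - d3 = y -> tau (index i j k + d1 - d3) = tau y by move->.
have phiE i j k (y : K) :
    index i j k = y -> phi (index i j k) = phi y by move->.
rewrite /lax_eq2 /op2 /redX /Psi /pw_Psi /T /pw_T !addrK ?subrK.
have l3_neq0 : a3 ^+ 2 * l2 != 0 by rewrite mulf_neq0 ?expf_neq0.
rewrite !exp_sqrD1 // !exp_sqrB1 // !expfzDr //.
rewrite ?exprN1 ?expr1z.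
rewrite (tauE (m1 + 1) (m2 - 1) _ (m + 2 * d1 - d2 - d3)); last by rewrite /m; index_ring.
rewrite (tauE m1 (m2 - 1) _ (m + d1 - d2)); last by rewrite /m; index_ring.
rewrite (tauE (m1 + 1) m2 _ (m + 2 * d1 - 2 * d3)); last by rewrite /m; index_ring.
rewrite (phiE (m1 + 1) (m2 - 1) _ (m + d1 - d2)); last by rewrite /m; index_ring.
rewrite (phiE (m1 + 1) m2 (m3 - 1) (m + d1 - d3)); last by rewrite /m; index_ring.
rewrite -/m.
have n3 : tau (m + 2 * d1 - d2 - d3) != 0
  by apply: (tau_shift_neq0 2 (- 1) (- 1) mL); ring.
have n4 : tau (m + d1 - d3) != 0 by apply: (tau_shift_neq0 1 0 (- 1) mL); ring.
have := expfz_neq0 m1 a1_neq0; have := expfz_neq0 m2 a2_neq0.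
have := expfz_neq0 m3 a3_neq0; have := expfz_neq0 (m1 ^+ 2) a1_neq0.
have := expfz_neq0 (m2 ^+ 2) a2_neq0; have := expfz_neq0 (m3 ^+ 2) a3_neq0.
have := expfz_neq0 m1 l1_neq0; have := expfz_neq0 m2 l2_neq0.
have := expfz_neq0 m3 l3_neq0.
move: (l1 ^ m1) (l2 ^ m2) ((a3 ^+ 2 * l2) ^ m3).
move: (a1 ^ (m1 ^+ 2)) (a2 ^ (m2 ^+ 2)) (a3 ^ (m3 ^+ 2)).
move: (a1 ^ m1) (a2 ^ m2) (a3 ^ m3).
move=> B1 B2 B3 A1 A2 A3 L1 L2 L3 h1 h2 h3 h4 h5 h6 h7 h8 h9.
(* Minus the coefficient of [phi (m + d1 - d2)] on the right of the Lax equation; the sign appears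
   because that term sits on the left of the reduced one. *)
apply: (@eq_scaled _ (- l1 * l2^-1 * L1 * L2 * L3 * A1 ^+ 2 * A2 ^+ 2
  * A3 ^+ 2 * B1 ^+ 2 / B2 ^+ 2 * a1 * a2
  * tau (m + d1 - d3) * tau (m + 2 * d1 - d2 - d3))).
  by rewrite !mulf_neq0 ?invr_neq0 ?expf_neq0 ?oppr_eq0.
by field; rewrite ?(h1, h2, h3, h4, h5, h6, h7, h8, h9, n3, n4, a1_neq0,
  a2_neq0, a3_neq0, l1_neq0, l2_neq0).
Qed.

End Lattice.

(** * Assembly of the reduction and its two compatibility conditions *)

Theorem proposition2p1 (K : numFieldType) (F : fieldType)
    (m0 d1 d2 d3 : K)
    (hd1 : int_or_half_int d1) (hd2 : int_or_half_int d2)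
    (hd3 : int_or_half_int d3)
    (d12 : d1 != d2) (d13 : d1 != d3) (d23 : d2 != d3)
    (dmax : Num.max d2 d3 < d1)
    (a1 a2 a3 l1 l2 l3 beta zeta xi : F)
    (ha1 : a1 != 0) (ha2 : a2 != 0) (ha3 : a3 != 0)
    (hl1 : l1 != 0) (hl2 : l2 != 0) (hl3 : l3 = a3 ^+ 2 * l2)
    (hbeta : beta = a3 ^+ 2 / a1 ^+ 2)
    (hzeta : zeta = l2 * l1^-1)
    (hxi : xi = (a1 ^+ 2 * l1 * l2)^-1)
    (tau : K -> F)
    (htau : forall m, on_lattice m0 d1 d2 d3 m -> tau m != 0) :
  (* the overall shift of the tau variables relative to phi *)
  let T := pw_T m0 d1 d2 d3 a1 a2 a3 (fun m => tau (m + d1 - d3)) in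
  let Psi phi :=
    pw_Psi m0 d1 d2 d3 a1 a2 a3 l1 l2 l3 (fun m => tau (m + d1 - d3)) phi in
  (forall (phi : K -> F) (m1 m2 m3 : int),
     let m := pw_index m0 d1 d2 d3 m1 m2 m3 in
     (lax_eq1 T (Psi phi) m1 m2 m3 <->
        redY d1 d2 d3 tau m * phi (m + d1 + d2)
          + beta * zeta * phi (m + d2 + d3) = xi * phi m)
     /\
     (lax_eq2 T (Psi phi) (m1 + 1) (m2 - 1) m3 <->
        phi (m + d1 - d2) - redX d1 d2 d3 tau m * phi (m + d1 - d3)
          = zeta * phi m))
  /\
  (reduced_compatible m0 d1 d2 d3 beta zeta tau <->
     somos_periodic m0 d1 d2 d3 (2 * d1) beta tau)
  /\
  (hm_compatibility T <->
     somos_periodic m0 d1 d2 d3 (2 * d1) beta tau).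
Proof.
(* The order of a [numFieldType] is partial, so the bound on the maximum splits only after the
   half-integers are seen to be real, hence comparable. *)
have [lt21 lt31] : d2 < d1 /\ d3 < d1.
  have [k1 d1E] := int_or_half_intE hd1; have [k2 d2E] := int_or_half_intE hd2.
  have [k3 d3E] := int_or_half_intE hd3.
  have dR (k : int) : k%:~R / 2 \is @Num.real K by rewrite realM ?realz ?realV.
  by move: dmax; rewrite comparable_gt_max ?real_comparable ?d2E ?d3E ?dR // => /andP[].
have zeta0 : zeta != 0 by rewrite hzeta mulf_neq0 ?invr_neq0.
split; last split.
- move=> phi m1 m2 m3; rewrite hbeta hzeta hxi hl3; split.
    exact: lax_eq1_reduction.
  exact: lax_eq2_reduction.
- exact: reduced_compatibleE.
- by rewrite hbeta; apply: hm_compatibilityE.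
Qed.
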